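(* Let $\mathcal{A}$ be a finite alphabet and let $\sigma:\mathcal{A}^{\mathbb{N}}\to\mathcal{A}^{\mathbb{N}}$, $\sigma(a_0a_1a_2\cdots)=a_1a_2a_3\cdots$, be the one-sided shift. (1) For any path set $\mathcal{P}\subseteq\mathcal{A}^{\mathbb{N}}$, the shifted set $\sigma(\mathcal{P})$ is a path set. (2) For any path set $\mathcal{P}\subseteq\mathcal{A}^{\mathbb{N}}$, the one-sided shift closure $\overline{\mathcal{P}}=\bigcup_{j\ge 0}\sigma^j(\mathcal{P})$ is a path set. (3) Every shift-invariant path set $\mathcal{P}\subseteq\mathcal{A}^{\mathbb{N}}$ is a one-sided sofic shift, and conversely every one-sided sofic shift in $\mathcal{A}^{\mathbb{N}}$ is a shift-invariant path set.
   Context: $\mathcal{A}^{\mathbb{N}}$ is the set of one-sided infinite sequences $a_0a_1a_2\cdots$ with $a_i\in\mathcal{A}$. A labeled directed graph over $\mathcal{A}$ is a finite directed graph $\mathcal{G}$ whose edges carry labels from $\mathcal{A}$; loops and multiple edges are allowed, but the triples (initial vertex, terminal vertex, label) are required to be distinct. A pointed graph $(\mathcal{G},v)$ is such a graph with a distinguished vertex $v$. The path set $X_{\mathcal{G}}(v)\subseteq\mathcal{A}^{\mathbb{N}}$ is the set of all sequences of successive edge labels of one-sided infinite walks in $\mathcal{G}$ starting at $v$. A subset of $\mathcal{A}^{\mathbb{N}}$ is a path set if it equals $X_{\mathcal{G}}(v)$ for some pointed graph $(\mathcal{G},v)$ over $\mathcal{A}$. A set $X\subseteq\mathcal{A}^{\mathbb{N}}$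 is shift-invariant if $\sigma(X)\subseteq X$. A one-sided sofic shift is a subset $Y\subseteq\mathcal{A}^{\mathbb{N}}$ consisting of all label sequences of one-sided infinite walks in some finite labeled directed graph $\mathcal{G}$ over $\mathcal{A}$, starting from any vertex of $\mathcal{G}$. *)

(* Defs.v *)
From mathcomp Require Import all_boot.
From mathcomp Require Import boolp classical_sets.
Set Implicit Arguments.
Unset Strict Implicit.
Unset Printing Implicit Defensive.
Local Open Scope classical_set_scope.

Definition shift (A : Type) (x : nat -> A) : nat -> A := fun n => x n.+1.

(* Edges form a type of their own; [edge_triple_inj] says that no
   two edges share initial vertex, terminal vertex and label.  The graph may
   have no vertices, and vertices may have no outgoing edges. *)
Record labeled_graph (A : finType) := LabeledGraph {
  vertex : finType;
  edge : finType;
  initial : edge -> vertex;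
  terminal : edge -> vertex;
  label : edge -> A;
  edge_triple_inj : injective (fun e => (initial e, terminal e, label e))
}.

Definition infinite_walk (A : finType) (G : labeled_graph A)
    (w : nat -> edge G) : Prop :=
  forall n, terminal (w n) = initial (w n.+1).

Definition label_sequence (A : finType) (G : labeled_graph A)
    (w : nat -> edge G) : nat -> A :=
  fun n => label (w n).

Definition walks_from (A : finType) (G : labeled_graph A) (v : vertex G) :
    set (nat -> edge G) :=
  [set w | infinite_walk w /\ initial (w 0) = v].

Definition path_set_of (A : finType) (G : labeled_graph A) (v : vertex G) :
    set (nat -> A) :=
  @label_sequence A G @` walks_from v.

Definition is_path_set (A : finType) (X : set (nat -> A)) : Prop :=
  exists (G : labeled_graph A) (v : vertex G), X = path_set_of v.

Definition shift_invariant (A : finType) (X : set (nat -> A)) : Prop :=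
  @shift A @` X `<=` X.

Definition shift_closure (A : finType) (X : set (nat -> A)) :
    set (nat -> A) :=
  \bigcup_(j in [set: nat]) (iter j (@shift A) @` X).

Definition is_one_sided_sofic (A : finType) (Y : set (nat -> A)) : Prop :=
  exists G : labeled_graph A,
    Y = @label_sequence A G @` [set w | infinite_walk w].

(* Main.v *)
Require Import Defs.
From mathcomp Require Import all_boot.
From mathcomp Require Import boolp classical_sets.
Local Open Scope classical_set_scope.

(** Everything reduces to one construction: the label sequences of walks that
start anywhere in a prescribed set [S] of vertices form a path set, because one
may add a fresh pointed vertex with no incoming edges and a copy of each edge
leaving [S].  For a path set [P] at [v], the union of the sets [shift^j P] over
[j] in [J] is of this form, where [S] consists of the vertices visited at some
time [j] in [J] by an infinite walk from [v]; [J = {1}] gives the shift and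
[J = nat] the shift closure.  If [P] is shift-invariant, it is the sofic shift
of the subgraph of edges used by infinite walks from [v]. *)

Lemma iter_shiftE (A : Type) (j : nat) (x : nat -> A) :
  iter j (@shift A) x = fun n => x (j + n).
Proof.
elim: j => [|j IHj] //=.
by rewrite IHj; apply/funext => n; rewrite /shift addSnnS.
Qed.

Section Walks.
Context {A : finType} {G : labeled_graph A}.
Implicit Types (w u : nat -> edge G) (v : vertex G) (S : set (vertex G)).

Lemma infinite_walk_drop w j :
  infinite_walk w -> infinite_walk (fun n => w (j + n)).
Proof. by move=> walk_w n; rewrite walk_w addnS. Qed.

Definition splice w j u : nat -> edge G :=
  fun n => if n < j then w n else u (n - j).

Lemma splice_drop w j u n : splice w j u (j + n) = u n.
Proof. by rewrite /splice ltnNge leq_addr addKn. Qed.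

Lemma splice_walks_from v w j u :
  walks_from v w -> infinite_walk u -> initial (u 0) = initial (w j) ->
  walks_from v (splice w j u).
Proof.
move=> [walk_w w0] walk_u u0; split=> [n|]; rewrite /splice.
  case: (ltngtP n.+1 j) => [lt_nj | lt_jn | eq_nj].
  - by rewrite walk_w.
  - by rewrite subSn // walk_u.
  - by rewrite eq_nj subnn u0 -eq_nj walk_w.
(* For [j = 0] nothing of [w] is left, and the start is [v] only through [u0]. *)
by case: j u0 => [|j] //= u0; rewrite u0.
Qed.

Definition sequences_from S : set (nat -> A) :=
  @label_sequence A G @` [set w | infinite_walk w /\ S (initial (w 0))].

(* The source [None] is the fresh vertex; it stands for any vertex of [S]. *)
Definition pointed_edge S (t : option (vertex G) * vertex G * A) : Prop :=
  exists e : edge G,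
    [/\ (if t.1.1 is Some x then initial e = x else S (initial e)),
        terminal e = t.1.2 & label e = t.2].

(** Edges are bare triples: copies at [None] of edges with the same terminal vertex and label must
    merge to keep triples distinct. *)
Definition pointed_edge_type S := {t | `[< pointed_edge S t >]}.

Lemma pointed_edge_inj S :
  injective (fun e : pointed_edge_type S =>
    ((val e).1.1, Some (val e).1.2, (val e).2)).
Proof.
move=> e f; case: (val e) (val f) (@val_inj _ _ _ e f) => [[? ?] ?] [[? ?] ?].
by move=> /= inj_ef [] eq1 eq2 eq3; apply: inj_ef; rewrite eq1 eq2 eq3.
Qed.

Definition pointed_graph S : labeled_graph A :=
  LabeledGraph (@pointed_edge_inj S).

Lemma sequences_from_is_path_set S : is_path_set (sequences_from S).
Proof.
exists (pointed_graph S), None; apply/seteqP; split=> x [w [walk_w w0] <-].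
  (* Only the first edge is replaced by its copy at the fresh vertex. *)
  pose s n := if n is m.+1 then Some (initial (w m.+1)) else None.
  have edge_s n : `[< pointed_edge S (s n, terminal (w n), label (w n)) >].
    by apply/asboolP; exists (w n); split=> //; case: n.
  exists (fun n => exist (fun t => `[< pointed_edge S t >]) _ (edge_s n)) => //; split=> // n.
  by rewrite /= walk_w.
have edge_w n : pointed_edge S (val (w n)) by apply/asboolP/(valP (w n)).
(* Lift each triple to an edge of [G]. After time 0 the source is a [Some], so the lifts fit
   together; the first lift starts in [S]. *)
have [u u_w] := choice edge_w.
exists u; last by apply/funext => n; have [_ _] := u_w n.
split=> [n|].
  have [_ -> _] := u_w n; have [+ _ _] := u_w n.+1.
  by have /= <- := walk_w n.
by have [+ _ _] := u_w 0; have /= -> := w0.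
Qed.

(** Dropping [j] edges of a walk from [v] leaves a walk from the vertex reached at time [j];
    conversely, splicing puts the [j] edges back in front. *)
Lemma bigcup_iter_shift_path_set_of (J : set nat) v :
  \bigcup_(j in J) (iter j (@shift A) @` path_set_of v) =
  sequences_from
    [set x | exists w j, [/\ walks_from v w, J j & initial (w j) = x]].
Proof.
apply/seteqP; split=> x.
  move=> [j Jj [_ [w w_v <-] <-]]; rewrite iter_shiftE.
  exists (fun n => w (j + n)) => //; split.
    by apply: infinite_walk_drop; case: w_v.
  by exists w, j; rewrite addn0.
move=> [u [walk_u [w [j [w_v Jj u0]]]] <-].
exists j => //; exists (label_sequence (splice w j u)).
  by exists (splice w j u) => //; apply: splice_walks_from.
by rewrite iter_shiftE; apply/funext => n; rewrite /label_sequence splice_drop.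
Qed.

Definition visited v (e : edge G) : Prop :=
  exists w j, walks_from v w /\ w j = e.

Definition visited_edge_type v := {e | `[< visited v e >]}.

Lemma visited_edge_inj v :
  injective (fun e : visited_edge_type v =>
    (initial (val e), terminal (val e), label (val e))).
Proof. by move=> e f /edge_triple_inj/val_inj. Qed.

Definition visited_graph v : labeled_graph A :=
  LabeledGraph (@visited_edge_inj v).

(** A walk here starts with a visited edge, hence at a vertex that a walk from [v] reaches. *)
Lemma visited_graph_sequences v :
  @label_sequence A (visited_graph v) @` [set w | infinite_walk w] =
  shift_closure (path_set_of v).
Proof.
rewrite /shift_closure bigcup_iter_shift_path_set_of.
apply/seteqP; split=> x.
  move=> [u walk_u <-]; exists (fun n => val (u n)) => //.
  have /asboolP[w [j [w_v wj]]] := valP (u 0).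
  by split=> //; exists w, j; rewrite wj.
move=> [u [walk_u [w [j [w_v _ u0]]]] <-].
have visited_u n : `[< visited v (u n) >].
  (* Following [w] up to time [j] and then [u] visits [u n] at time [j + n]. *)
  apply/asboolP; exists (splice w j u), (j + n); rewrite splice_drop.
  by split=> //; apply: splice_walks_from.
by exists (fun n => exist (fun e => `[< visited v e >]) _ (visited_u n)).
Qed.

End Walks.

Lemma shift_closure_invariant (A : finType) (X : set (nat -> A)) :
  shift_invariant X -> shift_closure X = X.
Proof.
move=> invX; apply/seteqP; split=> [x [j _ [y Xy <-]] | x Xx].
  by elim: j => //= j IHj; apply: invX; exists (iter j (@shift A) y).
by exists 0 => //; exists x.
Qed.

Theorem theorem1p4 (A : finType) :
  (forall P : set (nat -> A), is_path_set P -> is_path_set (@shift A @` P)) /\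
  (forall P : set (nat -> A), is_path_set P -> is_path_set (shift_closure P)) /\
  (forall P : set (nat -> A),
     is_path_set P -> shift_invariant P -> is_one_sided_sofic P) /\
  (forall Y : set (nat -> A),
     is_one_sided_sofic Y -> is_path_set Y /\ shift_invariant Y).
Proof.
split; [|split; [|split]].
- move=> _ [G [v ->]].
  rewrite -(bigcup_set1 (fun j => iter j (@shift A) @` path_set_of v) 1).
  rewrite bigcup_iter_shift_path_set_of; exact: sequences_from_is_path_set.
- move=> _ [G [v ->]]; rewrite /shift_closure bigcup_iter_shift_path_set_of.
  exact: sequences_from_is_path_set.
- move=> _ [G [v ->]] invP; exists (visited_graph v).
  by rewrite visited_graph_sequences shift_closure_invariant.
- move=> _ [G ->]; split.
    (* A sofic shift is the case where [S] consists of all vertices. *)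
    have -> : @label_sequence A G @` [set w | infinite_walk w] =
              sequences_from [set: vertex G].
      by congr (_ @` _); apply/seteqP; split=> w // [].
    exact: sequences_from_is_path_set.
  move=> _ [_ [w walk_w <-] <-].
  by exists (fun n => w (1 + n)) => //; apply: infinite_walk_drop.
Qed.
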